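(* Any nonadaptive comparison-based tester for unateness of functions $f:\{0,1\}^d\to\mathbb{R}$ with distance parameter $\varepsilon=1/8$ must make $\Omega(d\log d)$ queries.
   Context: A function $f:\{0,1\}^d\to\mathbb{R}$ is unate if for each $i\in[d]$ it is nonincreasing or nondecreasing in coordinate $i$; it is $\varepsilon$-far from unate if at least an $\varepsilon$ fraction of values must be changed to make it unate. A tester (with two-sided error) must accept unate functions with probability at least $2/3$ and reject functions $\varepsilon$-far from unate with probability at least $2/3$. It is nonadaptive if all queries are chosen in advance, and comparison-based if its decision depends only on the relative order (comparisons $<$, $=$, $>$) of the function values at the queried points, not on the values themselves. *)

(* Defs.v *)
From HB Require Import structures.
From mathcomp Require Import all_boot all_order all_algebra.
From mathcomp Require Import all_classical all_reals all_analysis.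

Set Implicit Arguments.
Unset Strict Implicit.
Unset Printing Implicit Defensive.

Import Order.TTheory GRing.Theory Num.Theory.
Local Open Scope classical_set_scope.
Local Open Scope ring_scope.

Definition cube (d : nat) := {ffun 'I_d -> bool}.

Definition set_coord (d : nat) (x : cube d) (i : 'I_d) (b : bool) : cube d :=
  [ffun j => if j == i then b else x j].

Definition nondecreasing_in (R : realType) (d : nat) (f : cube d -> R)
    (i : 'I_d) : Prop :=
  forall x : cube d, f (set_coord x i false) <= f (set_coord x i true).

Definition nonincreasing_in (R : realType) (d : nat) (f : cube d -> R)
    (i : 'I_d) : Prop :=
  forall x : cube d, f (set_coord x i true) <= f (set_coord x i false).

Definition unate (R : realType) (d : nat) (f : cube d -> R) : Prop :=
  forall i : 'I_d, nonincreasing_in f i \/ nondecreasing_in f i.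

Definition hamming_dist (R : realType) (d : nat) (f g : cube d -> R) : R :=
  #|[set x : cube d | f x != g x]%SET|%:R / #|{: cube d}|%:R.

Definition far_from_unate (R : realType) (d : nat) (eps : R)
    (f : cube d -> R) : Prop :=
  forall g : cube d -> R, unate g -> eps <= hamming_dist f g.

(* All the randomness of the tester is in the seed [w : Omega]. The queries
   depend on the seed only, which is nonadaptivity; [decide w] reads the answers
   in the order of the list [query w] and returns [true] for acceptance.
   The number of queries may depend on the seed. *)
Record nonadaptive_algorithm (R : realType) (disp : measure_display)
    (Omega : measurableType disp) (d : nat) := NonadaptiveAlgorithm {
  query : Omega -> seq (cube d);
  decide : Omega -> seq R -> bool;
  measurable_accept : forall f : cube d -> R,
    measurable [set w : Omega | decide w (map f (query w))]
}.

Definition accepts (R : realType) (disp : measure_display)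
    (Omega : measurableType disp) (d : nat)
    (T : nonadaptive_algorithm R Omega d) (f : cube d -> R) (w : Omega) : bool :=
  decide T w (map f (query T w)).

Definition makes_at_most (R : realType) (disp : measure_display)
    (Omega : measurableType disp) (d : nat)
    (T : nonadaptive_algorithm R Omega d) (q : nat) : Prop :=
  forall w : Omega, (size (query T w) <= q)%N.

Definition same_order_on (R : realType) (d : nat) (s : seq (cube d))
    (f g : cube d -> R) : Prop :=
  forall x y : cube d, x \in s -> y \in s ->
    [/\ (f x < f y) = (g x < g y),
        (f x == f y) = (g x == g y) &
        (f x > f y) = (g x > g y)].

Definition comparison_based (R : realType) (disp : measure_display)
    (Omega : measurableType disp) (d : nat)
    (T : nonadaptive_algorithm R Omega d) : Prop :=
  forall (w : Omega) (f g : cube d -> R),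
    same_order_on (query T w) f g -> accepts T f w = accepts T g w.

Definition unateness_tester (R : realType) (disp : measure_display)
    (Omega : measurableType disp) (P : probability Omega R) (d : nat) (eps : R)
    (T : nonadaptive_algorithm R Omega d) : Prop :=
  (forall f : cube d -> R, unate f ->
     ((2 / 3)%:E <= P [set w | accepts T f w])%E) /\
  (forall f : cube d -> R, far_from_unate eps f ->
     ((2 / 3)%:E <= P [set w | ~~ accepts T f w])%E).

(* Main.v *)
(* Yao's argument with an explicit pair of distributions, at a random one of
   [l] scales, [l] being of order [log d].  The first [l] coordinates cut the
   cube into [2 ^ l] subcubes.  At scale [k] each subcube [i] receives, through
   [2 ^ k] random classes, one of the remaining [n = d - l] coordinates, [r i].
   The coordinates in the image of [r] are hidden: inside the subcube [i] the
   function depends only on the visible coordinates, written in binary, and on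
   the bit [r i], which is the least significant one and carries a sign.  If the
   sign depends only on [r i], the function is unate.  If for each coordinate
   half of the subcubes holding it get the opposite sign, then a unate function
   disagrees with it on half of a quarter of the subcubes.

   The order of the values at the queries differs in the two cases only if two
   subcubes [i <> j] with [r i = r j] both reveal their sign, that is, if each
   contains two queries that differ in [r i] and agree on all visible
   coordinates.  With high probability no two queries differing in three or more
   of the [n] coordinates have all these differences hidden, and the pairs at
   distance at most two involve at most [2 q] (subcube, coordinate) incidences,
   because a spanning forest of these pairs already sees all the coordinates.
   A coordinate captured in [A] subcubes yields a collision at scale [k] with
   probability at most [min (2 ^ k, 2 A ^ 2 / 2 ^ k) / n]; summed over the
   scales this is [O (A / n)], so that the average over the scales is
   [O (q / (d log d))]. *)

Require Import Defs.
From HB Require Import structures.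
From mathcomp Require Import all_boot all_order all_algebra.
From mathcomp Require Import all_classical all_reals all_analysis.
From mathcomp Require Import measurable_realfun.
From mathcomp Require Import zify ring lra.

Set Implicit Arguments.
Unset Strict Implicit.
Unset Printing Implicit Defensive.

Import Order.TTheory GRing.Theory Num.Theory.
Local Open Scope ring_scope.

(** * Coordinates seen by pairs of close points *)

Section Forest.
Local Open Scope nat_scope.
Variables (X A : finType) (D : X -> X -> {set A}) (b : nat).
Hypothesis D_refl : forall x, D x x = finset.set0.
Hypothesis D_sym : forall x y, D x y = D y x.
Hypothesis D_tri : forall x y z, D x z \subset D x y :|: D y z.

(* Adding the edges one at a time, an edge inside a component of the current
   graph brings nothing new, by the triangle inequality for [D]; [phi] labels
   the components. *)
Lemma component_labelling (S : {set X}) (E : seq (X * X)) :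
  (forall p, p \in E -> [/\ p.1 \in S, p.2 \in S & #|D p.1 p.2| <= b]) ->
  exists (phi : X -> X) (M : {set A}),
    [/\ forall p, p \in E -> D p.1 p.2 \subset M,
        forall x y, phi x = phi y -> D x y \subset M &
        #|M| + b * #|phi @: S| <= b * #|S|].
Proof.
elim: E => [|[x y] E IH] hE.
  exists id, finset.set0; split=> // [u v /= ->|].
    by rewrite D_refl fintype.subxx.
  by rewrite cards0 imset_id.
have [|phi [M [hM hphi hcard]]] := IH.
  by move=> p pE; apply: hE; rewrite in_cons pE orbT.
have /= [xS yS Dxy] := hE (x, y) (mem_head _ _).
have [exy|nxy] := eqVneq (phi x) (phi y).
  exists phi, M; split=> // p; rewrite inE => /orP[/eqP ->|/hM //].
  exact: hphi.
exists (fun z => if phi z == phi y then phi x else phi z), (M :|: D x y); split.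
- move=> p; rewrite inE => /orP[/eqP ->|/hM hp]; first exact: finset.subsetUr.
  exact: fintype.subset_trans hp (finset.subsetUl _ _).
- have tri3 u v : phi u = phi x -> phi v = phi y -> D u v \subset M :|: D x y.
    move=> eu ev; apply: fintype.subset_trans (D_tri u x v) _.
    rewrite finset.subUset (fintype.subset_trans (hphi _ _ eu) (finset.subsetUl _ _)) /=.
    apply: fintype.subset_trans (D_tri x y v) _.
    rewrite finset.subUset finset.subsetUr /=.
    exact: fintype.subset_trans (hphi _ _ (esym ev)) (finset.subsetUl _ _).
  move=> u v.
  case: eqP => [eu|_]; case: eqP => [ev|_] e; rewrite ?eu ?ev in e.
  + apply: fintype.subset_trans (finset.subsetUl _ _).
    by apply: hphi; rewrite eu ev.
  + by rewrite D_sym; apply: tri3.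
  + by apply: tri3.
  + by apply: fintype.subset_trans (finset.subsetUl _ _); apply: hphi.
- have sub : [set (if phi z == phi y then phi x else phi z) | z in S]
              \subset (phi @: S) :\ phi y.
    apply/fintype.subsetP => _ /imsetP[z zS ->]; rewrite !inE.
    case: ifP => [_|/negbT hz]; first by rewrite nxy imset_f.
    by rewrite hz imset_f.
  have := cardsD1 (phi y) (phi @: S); rewrite imset_f //= => hc.
  have := subset_leq_card sub.
  have [+ _] := leq_card_setU M (D x y).
  move: hcard Dxy; rewrite hc mulnDr muln1 => h1 h2 h3 h4.
  have : b * #|[set (if phi z == phi y then phi x else phi z) | z in S]|
         <= b * #|(phi @: S) :\ phi y| by rewrite leq_mul2l h4 orbT.
  lia.
Qed.

(** The bound is linear in [S] although quadratically many pairs contribute: [component_labelling]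
    is applied to the list of all short pairs, and only its merging edges cost anything. *)
Lemma card_bigcup_short (S : {set X}) :
  #|\bigcup_(p in finset.setX S S | #|D p.1 p.2| <= b) D p.1 p.2| <= b * #|S|.
Proof.
pose E := [seq p <- enum (finset.setX S S) | #|D p.1 p.2| <= b].
have [|phi [M [hM _ hcard]]] := @component_labelling S E.
  by move=> [x y]; rewrite mem_filter mem_enum inE => /and3P[].
apply: leq_trans (leq_trans (leq_addr _ _) hcard).
apply/subset_leq_card/bigcupsP => p /andP[pS pb].
by apply: hM; rewrite mem_filter pb mem_enum.
Qed.
End Forest.

(** * Auxiliary counts: halves of a set, functions with prescribed values *)

Section Halves.
Local Open Scope nat_scope.
Variable T : finType.

Definition half_set (A : {set T}) : {set T} :=
  [set x in take #|A|./2 (enum A)].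

Lemma half_set_sub (A : {set T}) : half_set A \subset A.
Proof.
by apply/fintype.subsetP => x; rewrite inE => /mem_take; rewrite mem_enum.
Qed.

Lemma card_half_set (A : {set T}) : #|half_set A| = #|A|./2.
Proof.
rewrite cardsE (card_uniqP _) ?take_uniq ?enum_uniq // size_take -cardE.
by case: ltnP => //; lia.
Qed.

Lemma card_half_split (A : {set T}) (b : bool) :
  #|A|./2 <= #|[set x in A | (x \in half_set A) == b]|.
Proof.
case: b.
  rewrite -card_half_set; apply/subset_leq_card/fintype.subsetP => x xA.
  by rewrite inE xA (fintype.subsetP (half_set_sub A)).
have -> : [set x in A | (x \in half_set A) == false] = A :\: half_set A.
  by apply/finset.setP => x; rewrite !inE eqbF_neg andbC.
rewrite cardsD (finset.setIidPr (half_set_sub A)) card_half_set; lia.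
Qed.
End Halves.

Section FfunCount.
Local Open Scope nat_scope.
Variables (X Y : finType).

(** The product form avoids a subtraction in the exponent: each prescribed point contributes a
    factor 1, which the second factor brings back to [#|Y|]. *)
Lemma card_ffun_prescribed (S : {set X}) (v : X -> Y) :
  #|[set h : {ffun X -> Y} | [forall x in S, h x == v x]]| * #|Y| ^ #|S|
  = #|Y| ^ #|X|.
Proof.
pose F x : pred Y := if x \in S then pred1 (v x) else predT.
have -> : #|[set h : {ffun X -> Y} | [forall x in S, h x == v x]]|
          = #|family F|.
  apply: eq_card => h; rewrite inE.
  apply/forall_inP/familyP => [H x|H x xS].
    by rewrite /F; case: ifP => [/H|_].
  by have := H x; rewrite /F xS.
rewrite card_family foldrE big_map big_enum /= -!prod_nat_const.
rewrite [\prod_(i in S) _]big_mkcond -big_split /=.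
apply: eq_bigr => x _; rewrite /F; case: ifP => _.
  by rewrite card1 mul1n.
by rewrite muln1.
Qed.

End FfunCount.

(** * The hard functions *)

(** Uniqueness of binary expansions: the parity gives the lowest bit, and half of the rest is an
    expansion with one bit fewer. *)
Lemma binary_inj (m : nat) (x y : 'I_m -> bool) :
  (\sum_(j < m) x j * 2 ^ j = \sum_(j < m) y j * 2 ^ j)%N -> x =1 y.
Proof.
elim: m x y => [|m IH] x y; first by move=> _ [].
have parity (z : 'I_m.+1 -> bool) : (\sum_(j < m.+1) z j * 2 ^ j
    = z ord0 + (\sum_(j < m) z (lift ord0 j) * 2 ^ j).*2)%N.
  rewrite big_ord_recl /= muln1 -muln2 big_distrl /=; congr addn.
  by apply: eq_bigr => j _; rewrite /bump /= add1n expnS; lia.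
rewrite !parity => e.
have [e0 e1] : x ord0 = y ord0 /\
   (\sum_(j < m) x (lift ord0 j) * 2 ^ j
    = \sum_(j < m) y (lift ord0 j) * 2 ^ j)%N.
  by move: e; case: (x ord0); case: (y ord0) => /= e; split => //; lia.
move=> j; case: (unliftP ord0 j) => [j' ->|-> //].
exact: (IH (fun j => x (lift ord0 j)) (fun j => y (lift ord0 j)) e1).
Qed.

Section Construction.
Variables l n : nat.
Implicit Types (x y : cube (l + n)) (i : cube l) (r : cube l -> 'I_n).
Implicit Types (s : cube l -> bool) (Q : seq (cube (l + n))).

Definition block x : cube l := [ffun j => x (lshift n j)].

Definition diffs x y : {set 'I_n} :=
  [set a | x (rshift l a) != y (rshift l a)].

Definition hidden r : {set 'I_n} := [set r i | i in finset.setT].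

Definition is_hidden r (j : 'I_(l + n)) : bool :=
  [exists a in hidden r, j == rshift l a].

(** The number whose binary digits are the visible coordinates, hidden ones being read as 0. It
    determines the visible coordinates and is strictly increasing in each of them. *)
Definition weight r x : nat :=
  (\sum_(j < l + n) (~~ is_hidden r j && x j) * 2 ^ j)%N.

(** Doubling the weight frees the lowest bit for the signed hidden coordinate, which can therefore
    never reverse a strict comparison of weights. *)
Definition hard r s x : nat :=
  ((weight r x).*2 + (x (rshift l (r (block x))) (+) s (block x)))%N.

Lemma is_hiddenP r (a : 'I_n) : is_hidden r (rshift l a) = (a \in hidden r).
Proof.
apply/exists_inP/idP => [[b bH /eqP /rshift_inj -> //]|aH].
by exists a.
Qed.

Lemma is_hiddenF r (j : 'I_l) : is_hidden r (lshift n j) = false.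
Proof.
by apply/exists_inP => -[b _ /eqP /(congr1 val) /= e]; have := ltn_ord j; lia.
Qed.

Lemma hidden_im r i : r i \in hidden r.
Proof. by apply: imset_f; rewrite inE. Qed.

Lemma weight_eqP r x y : weight r x = weight r y ->
  block x = block y /\ diffs x y \subset hidden r.
Proof.
move/binary_inj => e; split.
  by apply/ffunP => j; have := e (lshift n j); rewrite is_hiddenF !ffunE.
apply/fintype.subsetP => a; rewrite inE; apply: contraR => aH.
by have := e (rshift l a); rewrite is_hiddenP aH /= => ->.
Qed.

Lemma diffs_refl x : diffs x x = finset.set0.
Proof. by apply/finset.setP => a; rewrite !inE eqxx. Qed.

Lemma diffs_sym x y : diffs x y = diffs y x.
Proof. by apply/finset.setP => a; rewrite !inE eq_sym. Qed.

Lemma diffs_tri x y z : diffs x z \subset diffs x y :|: diffs y z.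
Proof.
apply/fintype.subsetP => a; rewrite !inE.
by case: (x _); case: (y _); case: (z _).
Qed.

Lemma set_coordE (d : nat) (x : cube d) (i j : 'I_d) (b : bool) :
  set_coord x i b j = if j == i then b else x j.
Proof. by rewrite ffunE. Qed.

Lemma weight_set_hidden r x j b : is_hidden r j ->
  weight r (set_coord x j b) = weight r x.
Proof.
move=> hj; apply: eq_bigr => k _; rewrite set_coordE.
by case: eqP => // ->; rewrite hj.
Qed.

Lemma weight_set_visible r x j : ~~ is_hidden r j ->
  (weight r (set_coord x j false) < weight r (set_coord x j true))%N.
Proof.
move=> hj; rewrite /weight (bigD1 j) //= [ltnRHS](bigD1 j) //= !set_coordE eqxx.
rewrite hj /= mul0n mul1n add0n.
rewrite (eq_bigr (fun k : 'I_(l + n) =>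
    (~~ is_hidden r k && set_coord x j true k) * 2 ^ k)%N); last first.
  by move=> k /negbTE kj; rewrite !set_coordE kj.
by rewrite -[ltnLHS]add0n ltn_add2r expn_gt0.
Qed.

Lemma block_set_rshift x a b : block (set_coord x (rshift l a) b) = block x.
Proof.
apply/ffunP => j; rewrite !ffunE; case: eqP => // e.
by have := congr1 val e => /=; have := ltn_ord j; lia.
Qed.

Lemma hard_set_visible r s x j : ~~ is_hidden r j ->
  (hard r s (set_coord x j false) <= hard r s (set_coord x j true))%N.
Proof.
move=> /(weight_set_visible x); rewrite /hard.
by case: (_ (+) _); case: (_ (+) _) => /=; lia.
Qed.

Lemma hard_set_hidden r s x a b : a \in hidden r ->
  hard r s (set_coord x (rshift l a) b)
  = if r (block x) == a then ((weight r x).*2 + (b (+) s (block x)))%N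
    else hard r s x.
Proof.
move=> aH; rewrite /hard weight_set_hidden ?is_hiddenP // block_set_rshift.
by rewrite set_coordE (inj_eq (@rshift_inj _ _)); case: eqP.
Qed.

(** A visible coordinate raises the weight, hence the value, whatever the sign. A hidden coordinate
    [a] acts only in the subcubes labelled [a], and there always in the direction given by
    [alpha a]. *)
Lemma unate_hard (R : realType) r (alpha : 'I_n -> bool) :
  unate (fun x => (hard r (alpha \o r) x)%:R : R).
Proof.
move=> j; have [/exists_inP[a aH /eqP ->]|hj] := boolP (is_hidden r j); last first.
  by right=> x; rewrite ler_nat hard_set_visible.
case ea : (alpha a); [left|right] => x; rewrite ler_nat !hard_set_hidden //=;
  by case: eqP => // ->; rewrite ea leq_add2l.
Qed.

Definition revealed r Q i : bool :=
  [exists x, exists y, [&& x \in Q, y \in Q, block x == i, block y == i,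
                           diffs x y \subset hidden r & r i \in diffs x y]].

(** Unequal weights settle a comparison regardless of the signs. Equal weights put both queries in
    one subcube, where the sign matters only if they differ in its coordinate; the pair then reveals
    the subcube. *)
Lemma same_order_hard (R : realType) r s s' Q :
  (forall i, revealed r Q i -> s i = s' i) ->
  same_order_on Q (fun x => (hard r s x)%:R : R) (fun x => (hard r s' x)%:R).
Proof.
move=> hs.
(* Equality is the failure of both strict comparisons, so the strict one suffices. *)
suff H x y : x \in Q -> y \in Q -> (hard r s x < hard r s y)%N
    = (hard r s' x < hard r s' y)%N.
  move=> x y xQ yQ; rewrite !ltr_nat !eqr_nat ?eqn_leq.
  have h1 := H _ _ xQ yQ; have h2 := H _ _ yQ xQ.
  by split=> //; rewrite leqNgt [X in _ && X]leqNgt h1 h2 -!leqNgt.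
move=> xQ yQ; rewrite /hard.
have [/weight_eqP [eb Dh]|nW] := eqVneq (weight r x) (weight r y); last first.
  by move/eqP: nW; case: (_ (+) _); case: (_ (+) _);
     case: (_ (+) _); case: (_ (+) _) => /=; lia.
rewrite -eb; set b := rshift l _; set i := block x.
case: (eqVneq (x b) (y b)) => [->|nb].
  by case: (y b); case: (s i); case: (s' i) => /=; lia.
rewrite hs //; apply/existsP; exists x; apply/existsP; exists y.
by rewrite xQ yQ -eb eqxx Dh inE nb.
Qed.

Definition beta r i : bool := i \in half_set [set j | r j == r i].

Definition hardYes r (alpha : 'I_n -> bool) x : nat :=
  hard r (fun i => alpha (r i)) x.

Definition hardNo r (alpha : 'I_n -> bool) x : nat :=
  hard r (fun i => alpha (r i) (+) beta r i) x.

(* If no coordinate is revealed by two subcubes, the signs of the two functions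
   can be matched on everything revealed by shifting [alpha] at the coordinate
   [r i] by the bit [beta r i] of the only subcube [i] that reveals it. *)
Lemma sum_accept_eq (R : realType) Q r (G : (cube (l + n) -> R) -> bool) :
  (forall f g, same_order_on Q f g -> G f = G g) ->
  (forall i j, revealed r Q i -> revealed r Q j -> r i = r j -> i = j) ->
  (\sum_(alpha : {ffun 'I_n -> bool}) G (fun x => (hardYes r alpha x)%:R)
   = \sum_(alpha : {ffun 'I_n -> bool}) G (fun x => (hardNo r alpha x)%:R))%N.
Proof.
move=> hG inj.
pose v a := if [pick i | revealed r Q i && (r i == a)] is Some i
            then beta r i else false.
have vE i : revealed r Q i -> v (r i) = beta r i.
  move=> hi; rewrite /v; case: pickP => [j /andP[hj /eqP e]|/(_ i)].
    by rewrite (inj _ _ hj hi e).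
  by rewrite hi eqxx.
pose flip (alpha : {ffun 'I_n -> bool}) := [ffun a => alpha a (+) v a].
have flipK : involutive flip.
  by move=> alpha; apply/ffunP => a; rewrite !ffunE -addbA addbb addbF.
rewrite [RHS](reindex_inj (can_inj flipK)) /=; apply: eq_bigr => alpha _.
congr nat_of_bool; apply: hG; apply: same_order_hard => i hi.
by rewrite ffunE vE // -addbA addbb addbF.
Qed.

Lemma card_cube (d : nat) : #|{: cube d}| = (2 ^ d)%N.
Proof. by rewrite card_ffun card_bool card_ord. Qed.

(** [glue] concatenates a subcube label in [B] with any choice of the last [n] coordinates, and is
    injective. *)
Lemma card_block_ge (B : {set cube l}) :
  (#|B| * 2 ^ n <= #|[set x : cube (l + n) | block x \in B]|)%N.
Proof.
pose glue (p : cube l * cube n) : cube (l + n) :=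
  [ffun j => match fintype.split j with inl u => p.1 u | inr v => p.2 v end].
have glueL p u : glue p (lshift n u) = p.1 u.
  by rewrite ffunE -[lshift n u]/(unsplit (inl u)) unsplitK.
have glueR p u : glue p (rshift l u) = p.2 u.
  by rewrite ffunE -[rshift l u]/(unsplit (inr u)) unsplitK.
have glue_inj : injective glue.
  move=> [p1 p2] [q1 q2] e; congr pair; apply/ffunP => u.
    by rewrite -(glueL (p1, p2)) e glueL.
  by rewrite -(glueR (p1, p2)) e glueR.
rewrite -(card_cube n) -[#|{: cube n}|]cardsT -cardsX -(card_imset _ glue_inj).
apply/subset_leq_card/fintype.subsetP => _ /imsetP[p pB ->].
move: pB; rewrite !inE andbT; congr (_ \in B).
by apply/ffunP => u; rewrite ffunE glueL.
Qed.

(** Whatever direction [delta] prescribes for a coordinate, half of the subcubes holding it, rounded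
    down, have the matching bit. The rounding costs at most one per hidden coordinate, whence the
    term [#|hidden r|]. *)
Lemma card_violated_ge r (alpha delta : 'I_n -> bool) :
  (2 ^ l <= 2 * #|[set i | (alpha (r i) (+) beta r i) == delta (r i)]|
            + #|hidden r|)%N.
Proof.
set B := [set i | _].
rewrite -card_cube -[#|{: cube l}|]sum1_card -[#|B|]sum1_card -sum1_card.
rewrite (partition_big r (fun a => a \in hidden r)) /=; last first.
  by move=> i _; apply: hidden_im.
rewrite (partition_big r (fun a => a \in hidden r)) /=; last first.
  by move=> i _; apply: hidden_im.
rewrite big_distrr -big_split /=; apply: leq_sum => a _.
rewrite !sum1dep_card.
set A := [set i | r i == a].
have -> : [set i | (i \in B) && (r i == a)]
   = [set i in A | (i \in half_set A) == (alpha a (+) delta a)].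
  apply/finset.setP => i; rewrite !inE andbC; case: (r i =P a) => //= e.
  rewrite /beta e -/A.
  rewrite /half_set inE.
  by case: (_ \in _); case: (alpha a); case: (delta a).
have := card_half_split A (alpha a (+) delta a).
have := odd_double_half #|A|.
case: (odd _) => /=; lia.
Qed.

(* Where the sign of a subcube contradicts the direction of [h] in [r i], the
   function and [h] differ at one of [x] and [flip x]. *)
Lemma hardNo_far (R : realType) r (alpha : 'I_n -> bool) :
  (2 * #|hidden r| <= 2 ^ l)%N ->
  far_from_unate (1 / 8) (fun x => (hardNo r alpha x)%:R : R).
Proof.
move=> hr h uh; set s := fun i => alpha (r i) (+) beta r i.
pose delta a := `[< nondecreasing_in h (rshift l a) >].
(* A true sign makes the function strictly decreasing in [r i], so equality with [delta] means that
   the two directions conflict. *)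
pose B := [set i | s i == delta (r i)].
pose Df := [set x | ((hardNo r alpha x)%:R : R) != h x].
pose co x := rshift l (r (block x)).
pose flip x := set_coord x (co x) (~~ x (co x)).
have blockF x : block (flip x) = block x by apply: block_set_rshift.
have flipK : involutive flip.
  move=> x; rewrite /flip /co blockF; apply/ffunP => j.
  by rewrite !set_coordE eqxx; case: eqP => // ->; rewrite negbK.
have hit x : block x \in B -> (x \in Df) || (flip x \in Df).
  move=> xB; apply/negPn/negP; rewrite negb_or !inE !negbK => /andP[/eqP e1 /eqP e2].
  have eT b : b = x (co x) \/ b = ~~ x (co x) ->
     h (set_coord x (co x) b)
     = ((weight r x).*2 + (b (+) s (block x)))%N%:R.
    move=> hb; have := hard_set_hidden s x b (hidden_im r (block x)).
    rewrite eqxx => <-; case: hb => ->; last by rewrite -e2.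
    suff -> : set_coord x (co x) (x (co x)) = x by rewrite -e1.
    by apply/ffunP => j; rewrite set_coordE; case: eqP => // ->.
  have eF : h (set_coord x (co x) false) = ((weight r x).*2 + s (block x))%N%:R.
    by rewrite eT //; case: (x _); [right|left].
  have eT' : h (set_coord x (co x) true)
             = ((weight r x).*2 + ~~ s (block x))%N%:R.
    by rewrite eT //; case: (x _); [left|right].
  move: xB; rewrite inE => /eqP es.
  have [|hd] := boolP (delta (r (block x))).
    move=> hd; have /asboolP /(_ x) := hd.
    by rewrite eF eT' es hd /= ler_nat leq_add2l.
  have [/(_ x)|/asboolT hd'] := uh (rshift l (r (block x))); last first.
    by move: hd; rewrite /delta hd'.
  by rewrite eF eT' es (negbTE hd) /= ler_nat leq_add2l.
(* The points above [B] are covered by [Df] and its image under the involution [flip]. *)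
have cB : (#|[set x : cube (l + n) | block x \in B]| <= 2 * #|Df|)%N.
  have -> : (2 * #|Df| = #|Df| + #|[set x | flip x \in Df]|)%N.
    rewrite mul2n -addnn; congr addn.
    rewrite -(card_imset _ (can_inj flipK)); apply: eq_card => x.
    apply/imsetP/idP => [[y yD ->]|]; first by rewrite inE flipK.
    by rewrite inE => xD; exists (flip x).
  have [le _] := leq_card_setU Df [set x | flip x \in Df].
  apply: leq_trans le; apply/subset_leq_card/fintype.subsetP => x xB.
  by rewrite finset.in_setU [_ \in [set x | flip x \in Df]]inE hit //; rewrite inE in xB.
have vB : (2 ^ l <= 2 * #|B| + #|hidden r|)%N := card_violated_ge r alpha delta.
have gB := card_block_ge B.
rewrite /hamming_dist card_cube ler_pdivlMr ?ltr0n ?expn_gt0 //.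
(* Since at most [2 ^ l / 2] coordinates are hidden, [B] has at least [2 ^ l / 4] elements; passing
   to [Df] loses another factor 2. *)
have : (2 ^ (l + n) <= 8 * #|Df|)%N.
  rewrite expnD; apply: (@leq_trans ((4 * #|B|) * 2 ^ n)%N).
    by rewrite leq_mul2r; apply/orP; right; lia.
  by rewrite -mulnA -[8%N]/(4 * 2)%N -[leqRHS]mulnA leq_mul2l (leq_trans gB cB).
rewrite -(ler_nat R) natrM.
lra.
Qed.

End Construction.

(** * The probability of a collision *)

Section Counting.
Local Open Scope nat_scope.

Lemma card_exists_le (U H : finType) (P : U -> pred H) :
  #|[set h | [exists u, P u h]]| <= \sum_u #|[set h | P u h]|.
Proof.
have -> : \sum_u #|[set h | P u h]| = \sum_h \sum_u (P u h : nat).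
  rewrite exchange_big /=; apply: eq_bigr => u _.
  by rewrite -sum1dep_card big_mkcond.
rewrite -sum1dep_card big_mkcond /=; apply: leq_sum => h _.
by case: existsP => // -[u Pu]; rewrite (bigD1 u) //= Pu.
Qed.

Variables (X Y : finType).

Lemma card_ffun1 (x : X) (y : Y) :
  #|[set h : {ffun X -> Y} | h x == y]| * #|Y| = #|{ffun X -> Y}|.
Proof.
rewrite card_ffun -(@card_ffun_prescribed X Y [set x] (fun=> y)) cards1 expn1.
congr (_ * _); apply: eq_card => h; rewrite !inE.
by apply/idP/forall_inP => [hx z|H]; [rewrite inE => /eqP -> | apply: H; rewrite inE].
Qed.

Lemma card_ffun2 (x1 x2 : X) (y1 y2 : Y) : x1 != x2 ->
  #|[set h : {ffun X -> Y} | (h x1 == y1) && (h x2 == y2)]| * #|Y| ^ 2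
  = #|{ffun X -> Y}|.
Proof.
move=> n12; rewrite card_ffun.
rewrite -(@card_ffun_prescribed X Y [set x1; x2]
            (fun z => if z == x1 then y1 else y2)) cards2 n12.
congr (_ * _); apply: eq_card => h; rewrite !inE.
apply/andP/forall_inP => [[h1 h2] z|H].
  rewrite !inE => /orP[/eqP ->|/eqP ->]; first by rewrite eqxx.
  by rewrite [x2 == x1]eq_sym (negbTE n12).
split; first by have := H x1; rewrite !inE !eqxx; apply.
by have := H x2; rewrite !inE !eqxx [x2 == x1]eq_sym (negbTE n12) orbT; apply.
Qed.

(** Only an inequality, since the points may coincide; in that case distinct values make the event
    empty. *)
Lemma card_ffun3 (x1 x2 x3 : X) (y1 y2 y3 : Y) :
  y1 != y2 -> y1 != y3 -> y2 != y3 ->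
  #|[set h : {ffun X -> Y} | [&& h x1 == y1, h x2 == y2 & h x3 == y3]]|
    * #|Y| ^ 3 <= #|{ffun X -> Y}|.
Proof.
move=> n12 n13 n23; set E := [set h : {ffun _ -> _} | _].
have [/eqP ->|] := boolP (E == finset.set0); first by rewrite cards0.
case/set0Pn => h0; rewrite inE => /and3P[/eqP e1 /eqP e2 /eqP e3].
have m12 : x1 != x2 by apply: contraNneq n12 => e; rewrite -e1 -e2 e.
have m13 : x1 != x3 by apply: contraNneq n13 => e; rewrite -e1 -e3 e.
have m23 : x2 != x3 by apply: contraNneq n23 => e; rewrite -e2 -e3 e.
rewrite card_ffun -(@card_ffun_prescribed X Y [set x1; x2; x3] h0).
rewrite finset.setUC cardsU1 cards2 !inE negb_or (eq_sym x3) m13 (eq_sym x3) m23 m12.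
rewrite leq_mul2r; apply/orP; right.
apply/subset_leq_card/fintype.subsetP => h.
rewrite !inE => /and3P[/eqP h1 /eqP h2 /eqP h3].
apply/forall_inP => z; rewrite !inE => /orP[/eqP ->|/orP[]/eqP ->].
- by rewrite h3 e3.
- by rewrite h1 e1.
- by rewrite h2 e2.
Qed.

End Counting.

(** * Random assignments of coordinates to subcubes *)

Section Assignments.
Local Open Scope nat_scope.
Variables l n N : nat.

(** Subcubes are first sent to [N] classes and classes then to coordinates, which keeps the number
    of hidden coordinates at most [N]. *)
Definition pattern : finType :=
  ({ffun cube l -> 'I_N} * {ffun 'I_N -> 'I_n})%type.

Definition assign (t : pattern) (i : cube l) : 'I_n := t.2 (t.1 i).

Lemma card_hidden_le (t : pattern) : #|hidden (assign t)| <= N.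
Proof.
apply: (@leq_trans #|[set t.2 u | u in finset.setT]|).
  apply/subset_leq_card/fintype.subsetP => _ /imsetP[i _ ->].
  by apply: imset_f; rewrite inE.
by rewrite (leq_trans (leq_imset_card _ _)) // cardsT card_ord.
Qed.

Lemma hiddenE (t : pattern) a :
  a \in hidden (assign t) -> exists u, t.2 u = a.
Proof. by case/imsetP => i _ ->; exists (t.1 i). Qed.

Lemma card_pattern_snd (P : pred {ffun 'I_N -> 'I_n}) :
  #|[set t : pattern | P t.2]| = N ^ (2 ^ l) * #|[set h | P h]|.
Proof.
have -> : [set t : pattern | P t.2] = finset.setX finset.setT [set h | P h].
  by apply/finset.setP => t; rewrite !inE.
by rewrite cardsX cardsT card_ffun card_cube card_ord.
Qed.

Lemma card_pattern :
  #|pattern| = N ^ (2 ^ l) * #|{ffun 'I_N -> 'I_n}|.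
Proof. by rewrite card_prod card_ffun card_cube card_ord. Qed.

Lemma card_hidden1 (a : 'I_n) :
  #|[set t : pattern | a \in hidden (assign t)]| * n <= N * #|pattern|.
Proof.
apply: (@leq_trans (#|[set t : pattern | [exists u, t.2 u == a]]| * n)).
  rewrite leq_mul2r; apply/orP; right.
  apply/subset_leq_card/fintype.subsetP => t; rewrite !inE => /hiddenE[u e].
  by apply/existsP; exists u; rewrite e.
rewrite (card_pattern_snd (fun h => [exists u, h u == a])) card_pattern.
rewrite mulnCA -mulnA leq_mul2l; apply/orP; right.
apply: leq_trans (leq_mul (card_exists_le _) (leqnn n)) _.
rewrite big_distrl /=.
rewrite (eq_bigr (fun=> #|{ffun 'I_N -> 'I_n}|)) ?sum_nat_const ?card_ord //.
by move=> u _; rewrite -(card_ffun1 u a) card_ord.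
Qed.

(** Three distinct elements of [A] must be the images of three classes: a union bound over [N ^ 3]
    triples, each of probability at most [n ^ -3]. *)
Lemma card_hidden3 (A : {set 'I_n}) : 2 < #|A| ->
  #|[set t : pattern | A \subset hidden (assign t)]| * n ^ 3
  <= N ^ 3 * #|pattern|.
Proof.
case/card_gt2P => a1 [a2 [a3 [[h1 h2 h3] [n12 n23 n31]]]].
pose P (p : 'I_N * 'I_N * 'I_N) (h : {ffun 'I_N -> 'I_n}) :=
  [&& h p.1.1 == a1, h p.1.2 == a2 & h p.2 == a3].
apply: (@leq_trans (#|[set t : pattern | [exists p, P p t.2]]| * n ^ 3)).
  rewrite leq_mul2r; apply/orP; right.
  apply/subset_leq_card/fintype.subsetP => t; rewrite !inE => /fintype.subsetP As.
  have [u1 e1] := hiddenE (As _ h1); have [u2 e2] := hiddenE (As _ h2).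
  have [u3 e3] := hiddenE (As _ h3).
  by apply/existsP; exists (u1, u2, u3); rewrite /P /= e1 e2 e3 !eqxx.
rewrite (card_pattern_snd (fun h => [exists p, P p h])) card_pattern.
rewrite mulnCA -mulnA leq_mul2l; apply/orP; right.
apply: leq_trans (leq_mul (card_exists_le _) (leqnn _)) _.
rewrite big_distrl /=.
apply: (@leq_trans (\sum_(p : 'I_N * 'I_N * 'I_N) #|{ffun 'I_N -> 'I_n}|)).
  apply: leq_sum => p _; rewrite -[n in n ^ 3]card_ord.
  by apply: card_ffun3 => //; rewrite eq_sym.
by rewrite sum_nat_const !card_prod !card_ord !expnS expn0 muln1 !mulnA.
Qed.

(** Sharing a class has probability [1 / N], and the class then goes to [a] with probability
    [1 / n]. Distinct classes both go to [a] with probability [1 / n ^ 2], at most [1 / (N * n)]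
    because [N <= n]. *)
Lemma card_collision (i j : cube l) (a : 'I_n) : i != j -> N <= n -> 0 < N ->
  #|[set t : pattern | (assign t i == a) && (assign t j == a)]| * (N * n)
  <= 2 * #|pattern|.
Proof.
move=> nij Nn N0.
pose W (p : 'I_N * 'I_N) : {set pattern} := finset.setX
   [set c : {ffun cube l -> 'I_N} | (c i == p.1) && (c j == p.2)]
   [set h : {ffun 'I_N -> 'I_n} | (h p.1 == a) && (h p.2 == a)].
have n0 : 0 < n by lia.
(* [W p] fixes the classes of [i] and [j]; on the diagonal the second map meets only one condition,
   which saves a factor [n]. *)
have WE p : #|W p| * (N ^ 2 * n ^ 2) = #|pattern| * (if p.1 == p.2 then n else 1).
  rewrite cardsX card_prod.
  have e1 := card_ffun2 p.1 p.2 nij; rewrite card_ord in e1.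
  rewrite mulnACA e1 -[RHS]mulnA; congr (_ * _).
  case: ifP => [/eqP <-|/negbT h].
    rewrite -(card_ffun1 p.1 a) card_ord -mulnA mulnn; congr (_ * _).
    by apply: eq_card => h; rewrite !inE andbb.
  by have := card_ffun2 a a h; rewrite card_ord muln1.
have sW : #|[set t : pattern | (assign t i == a) && (assign t j == a)]|
    <= \sum_p #|W p|.
  apply: (@leq_trans #|[set t : pattern | [exists p, t \in W p]]|).
    apply/subset_leq_card/fintype.subsetP => t; rewrite !inE => h.
    by apply/existsP; exists (t.1 i, t.1 j); rewrite !inE /= !eqxx.
  apply: leq_trans (card_exists_le _) _.
  by apply: leq_sum => p _; rewrite cardsE.
have NN : 0 < N * n by rewrite muln_gt0 N0.
rewrite -(leq_pmul2r NN) -[X in X <= _]mulnA.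
have -> : N * n * (N * n) = N ^ 2 * n ^ 2 by rewrite mulnACA !mulnn.
apply: leq_trans (leq_mul sW (leqnn _)) _.
rewrite big_distrl /= (eq_bigr _ (fun p _ => WE p)) -big_distrr /=.
rewrite -mulnA mulnCA leq_mul2l; apply/orP; right.
apply: (@leq_trans (\sum_(p : 'I_N * 'I_N) ((if p.1 == p.2 then n else 0) + 1))).
  by apply: leq_sum => p _; case: ifP => _; rewrite ?leq_addr.
rewrite big_split /= sum_nat_const card_prod card_ord.
rewrite -(pair_big xpredT xpredT (fun u v : 'I_N => if u == v then n else 0)) /=.
rewrite (eq_bigr (fun=> n)); last first.
  by move=> u _; rewrite -big_mkcond (big_pred1 u) // => v; rewrite eq_sym.
rewrite sum_nat_const card_ord muln1 mul2n -addnn leq_add2l leq_mul2l Nn.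
by rewrite orbT.
Qed.

End Assignments.

(** * Collisions between revealed subcubes *)

Section Collisions.
Variables l n : nat.
Implicit Types (x y : cube (l + n)) (i : cube l) (Q : seq (cube (l + n))).

Definition in_block Q i : {set cube (l + n)} := [set x in Q | block x == i].

Definition captured Q i : {set 'I_n} :=
  \bigcup_(p in finset.setX (in_block Q i) (in_block Q i)
           | (#|diffs p.1 p.2| <= 2)%N) diffs p.1 p.2.

Definition capturing Q (a : 'I_n) : {set cube l} := [set i | a \in captured Q i].

(** Double counting of the incidences, with the forest bound [card_bigcup_short] for [b = 2] in each
    subcube; the subcubes partition the queries. *)
Lemma sum_capturing_le Q : (\sum_a #|capturing Q a| <= 2 * size Q)%N.
Proof.
have -> : (\sum_a #|capturing Q a| = \sum_i #|captured Q i|)%N.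
  have -> : (\sum_a #|capturing Q a| = \sum_a \sum_i (a \in captured Q i : nat))%N.
    by apply: eq_bigr => a _; rewrite -sum1dep_card big_mkcond.
  rewrite exchange_big /=; apply: eq_bigr => i _.
  by rewrite -sum1_card [RHS]big_mkcond.
apply: (@leq_trans (\sum_i 2 * #|in_block Q i|)).
  apply: leq_sum => i _; apply: card_bigcup_short; first exact: diffs_refl.
    exact: diffs_sym.
  exact: diffs_tri.
rewrite -big_distrr /= leq_mul2l /=; apply: leq_trans (card_size Q).
rewrite -[#|Q|]sum1_card (partition_big (@block l n) xpredT) //=.
by apply: leq_sum => i _; rewrite sum1dep_card.
Qed.

Variable N : nat.

Definition collides Q (t : pattern l n N) : bool :=
  [exists i, exists j, [&& i != j, revealed (assign t) Q i,
                           revealed (assign t) Q j & assign t i == assign t j]].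

Definition far_pair_hidden Q (t : pattern l n N) : bool :=
  [exists p, [&& p.1 \in Q, p.2 \in Q, (2 < #|diffs p.1 p.2|)%N
                 & diffs p.1 p.2 \subset hidden (assign t)]].

Definition captured_collision Q a (t : pattern l n N) : bool :=
  [exists p : cube l * cube l,
    [&& p.1 \in capturing Q a, p.2 \in capturing Q a, p.1 != p.2
      & (assign t p.1 == a) && (assign t p.2 == a)]].

Lemma revealed_captured Q t i : ~~ far_pair_hidden Q t ->
  revealed (assign t) Q i -> i \in capturing Q (assign t i).
Proof.
move=> nf /existsP[x /existsP[y /and5P[xQ yQ bx by_ /andP[h ai]]]].
rewrite inE; apply/bigcupP; exists (x, y) => //=.
rewrite !inE /= xQ yQ bx by_ /= leqNgt; apply: contraNN nf => lt.
by apply/existsP; exists (x, y); rewrite /= xQ yQ lt h.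
Qed.

(** Unless a far pair is hidden, every revealing pair is at distance at most two, so both colliding
    subcubes capture their common coordinate. *)
Lemma card_collides_le Q :
  (#|[set t | collides Q t]| <= #|[set t | far_pair_hidden Q t]|
     + \sum_a #|[set t | captured_collision Q a t]|)%N.
Proof.
apply: (@leq_trans (#|[set t | far_pair_hidden Q t]|
   + #|[set t | [exists a, captured_collision Q a t]]|)); last first.
  by rewrite leq_add2l; apply: card_exists_le.
have [le _] := leq_card_setU [set t | far_pair_hidden Q t]
                 [set t | [exists a, captured_collision Q a t]].
apply: leq_trans le; apply/subset_leq_card/fintype.subsetP => t.
rewrite !inE => /existsP[i /existsP[j /and4P[nij ri rj /eqP e]]].
have [//|nf] := boolP (far_pair_hidden Q t).
apply/existsP; exists (assign t i); apply/existsP; exists (i, j).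
rewrite /= nij -e eqxx (revealed_captured nf ri) /=.
by rewrite e (revealed_captured nf rj).
Qed.

Lemma card_far_pair_hidden Q :
  (#|[set t | far_pair_hidden Q t]| * n ^ 3
   <= size Q ^ 2 * (N ^ 3 * #|pattern l n N|))%N.
Proof.
apply: leq_trans (leq_mul (card_exists_le _) (leqnn _)) _.
rewrite big_distrl /=.
apply: (@leq_trans (\sum_(p in finset.setX [set x in Q] [set x in Q])
                      N ^ 3 * #|pattern l n N|)); last first.
  rewrite sum_nat_const cardsX mulnn leq_mul2r leq_sqr cardsE card_size.
  by rewrite orbT.
rewrite [leqRHS]big_mkcond; apply: leq_sum => p _; rewrite !inE.
case: (p.1 \in Q) => /=; last by rewrite eq_card0 // => t; rewrite inE.
case: (p.2 \in Q) => /=; last by rewrite eq_card0 // => t; rewrite inE.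
have [lt|_] /= := boolP (2 < #|_|)%N; last by rewrite eq_card0 // => t; rewrite inE.
exact: card_hidden3.
Qed.

Lemma card_captured_collision1 Q a :
  (#|[set t | captured_collision Q a t]| * n <= N * #|pattern l n N|)%N.
Proof.
apply: leq_trans (card_hidden1 l N a); rewrite leq_mul2r; apply/orP; right.
apply/subset_leq_card/fintype.subsetP => t; rewrite !inE.
by move=> /existsP[p /and4P[_ _ _ /andP[/eqP <- _]]]; apply: hidden_im.
Qed.

Lemma card_captured_collision2 Q a : (0 < N)%N -> (N <= n)%N ->
  (#|[set t | captured_collision Q a t]| * (N * n)
   <= #|capturing Q a| ^ 2 * (2 * #|pattern l n N|))%N.
Proof.
move=> N0 Nn.
apply: leq_trans (leq_mul (card_exists_le _) (leqnn _)) _.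
rewrite big_distrl /=.
apply: (@leq_trans (\sum_(p in finset.setX (capturing Q a) (capturing Q a))
                      2 * #|pattern l n N|)); last first.
  by rewrite sum_nat_const cardsX mulnn.
rewrite [leqRHS]big_mkcond; apply: leq_sum => -[i j] _; rewrite finset.in_setX /=.
case: (i \in _) => /=; last by rewrite eq_card0 // => t; rewrite inE.
case: (j \in _) => /=; last by rewrite eq_card0 // => t; rewrite inE.
have [lt|_] /= := boolP (_ != _); last by rewrite eq_card0 // => t; rewrite inE.
exact: card_collision.
Qed.

Lemma pattern_gt0 : (0 < N)%N -> (0 < n)%N -> (0 < #|pattern l n N|)%N.
Proof.
by move=> N0 n0; rewrite card_pattern card_ffun !card_ord muln_gt0 !expn_gt0 N0 n0.
Qed.

(** The minimum keeps two bounds for each coordinate: it must be hidden at all, and two of the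
    subcubes capturing it must both receive it. *)
Lemma prob_collides_le (R : realFieldType) Q : (0 < N)%N -> (N <= n)%N ->
  #|[set t | collides Q t]|%:R / #|pattern l n N|%:R
  <= (size Q)%:R ^+ 2 * (N%:R / n%:R) ^+ 3
     + (\sum_a Num.min N%:R (2 * #|capturing Q a|%:R ^+ 2 / N%:R)) / n%:R :> R.
Proof.
move=> N0 Nn; have n0 : (0 < n)%N by apply: leq_trans Nn.
have T0 := pattern_gt0 N0 n0.
have N0' : (0 : R) < N%:R by rewrite ltr0n.
have n0' : (0 : R) < n%:R by rewrite ltr0n.
have T0' : (0 : R) < #|pattern l n N|%:R by rewrite ltr0n.
apply: (@le_trans _ _ ((#|[set t | far_pair_hidden Q t]|%:R
   + \sum_a #|[set t | captured_collision Q a t]|%:R) / #|pattern l n N|%:R)).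
  rewrite ler_pM2r ?invr_gt0 // -natr_sum -natrD ler_nat.
  exact: card_collides_le.
rewrite mulrDl; apply: lerD.
  rewrite exprMn exprVn mulrA ler_pdivrMr // mulrAC ler_pdivlMr ?exprn_gt0 //.
  by rewrite -mulrA -!natrX -!natrM ler_nat; apply: card_far_pair_hidden.
rewrite !mulr_suml; apply: ler_sum => a _.
rewrite ler_pdivrMr // mulrAC ler_pdivlMr // minr_pMl ?ler0n //.
rewrite le_min; apply/andP; split.
  by rewrite -!natrM ler_nat; apply: card_captured_collision1.
rewrite mulrAC ler_pdivlMr // -mulrA -!natrX -!natrM ler_nat.
rewrite [(n * N)%N]mulnC [(2 * _)%N]mulnC -mulnA.
exact: card_captured_collision2.
Qed.

End Collisions.

(* The summand is at most [2 ^ k] while [2 ^ k < A], and then decays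
   geometrically; the two regimes contribute [2 A] and [4 A]. *)
Lemma sum_min_geometric (R : realFieldType) (A K : nat) :
  \sum_(k < K) Num.min (2 ^ k)%:R (2 * A%:R ^+ 2 / (2 ^ k)%:R) <= 6 * A%:R :> R.
Proof.
(* Strengthened for induction: the subtracted term is the whole geometric tail of
   [2 * A ^ 2 / 2 ^ k] over [k >= K]. *)
suff : \sum_(k < K) Num.min (2 ^ k)%:R (2 * A%:R ^+ 2 / (2 ^ k)%:R)
   <= (if (2 ^ K < A)%N then (2 ^ K)%:R
       else 6 * A%:R - 4 * (A%:R ^+ 2 / (2 ^ K)%:R)) :> R.
  move=> h; apply: le_trans h _; case: ltnP => h.
    have : (2 ^ K)%:R <= A%:R :> R by rewrite ler_nat ltnW.
    have : 0 <= A%:R :> R by []. lra.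
  have : 0 <= A%:R ^+ 2 / (2 ^ K)%:R :> R by rewrite divr_ge0 ?exprn_ge0 // ler0n.
  lra.
elim: K => [|K IH].
  rewrite big_ord0 expn0; case: ifP => [_|/negbT]; first exact: ler01.
  by rewrite -leqNgt; case: A => [|[|//]] _; lra.
rewrite big_ord_recr /=; move: IH; set S := \sum_(_ < _) _.
have : (0 : R) < (2 ^ K)%:R by rewrite ltr0n expn_gt0.
rewrite expnS natrM.
have -> : (2 ^ K < A)%N = ((2 ^ K)%:R < A%:R :> R) by rewrite ltr_nat.
have -> : (2 * 2 ^ K < A)%N = (2 * (2 ^ K)%:R < A%:R :> R).
  by rewrite -natrM ltr_nat.
have : 0 <= A%:R :> R by [].
move: (A%:R : R) ((2 ^ K)%:R : R) => a z a0 z0.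
have az : a = a / z * z by rewrite divfK // gt_eqF.
have -> : 2 * a ^+ 2 / z = 2 * a * (a / z) by field; rewrite gt_eqF.
have -> : a ^+ 2 / z = a * (a / z) by field; rewrite gt_eqF.
have -> : a ^+ 2 / (2 * z) = a * (a / z) / 2 by field; rewrite gt_eqF.
move: (a / z) az => w az.
have w0 : 0 <= w by rewrite -(pmulr_lge0 _ z0) -az.
have m1 : Num.min z (2 * a * w) <= z by rewrite ge_min lexx.
have m2 : Num.min z (2 * a * w) <= 2 * a * w by rewrite ge_min lexx orbT.
case: (ltP z a) => h1 h; case: (ltP (2 * z) a) => h2; try lra.
(* What remains is the crossing between the regimes, [z < a <= 2 * z]. *)
have w2 : w <= 2 by rewrite -(ler_pM2r z0) -az.
have : a * w <= a * 2 by rewrite ler_wpM2l.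
lra.
Qed.

(** * Averaging over the scales and over the seed *)

Section Mixture.
Variables (R : realType) (l n : nat).

(** A dependent pair, because the type of patterns varies with the scale [k]. Both distributions use
    this index set and the same weights: a uniform scale, then a uniform pattern and uniform
    signs. *)
Definition instance : finType :=
  {k : 'I_l & (pattern l n (2 ^ k) * {ffun 'I_n -> bool})%type}.

Definition instance_weight (j : instance) : R :=
  (l%:R * #|pattern l n (2 ^ tag j)|%:R * (2 ^ n)%:R)^-1.

Definition yes_instance (j : instance) (x : cube (l + n)) : R :=
  (hardYes (assign (tagged j).1) (tagged j).2 x)%:R.

Definition no_instance (j : instance) (x : cube (l + n)) : R :=
  (hardNo (assign (tagged j).1) (tagged j).2 x)%:R.

Lemma instance_weight_ge0 (j : instance) : 0 <= instance_weight j.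
Proof. by rewrite invr_ge0 !mulr_ge0 ?ler0n. Qed.

Lemma sum_instance (F : forall k : 'I_l, pattern l n (2 ^ k) ->
    {ffun 'I_n -> bool} -> R) :
  \sum_(j : instance) instance_weight j * F (tag j) (tagged j).1 (tagged j).2
  = \sum_(k < l) (l%:R * #|pattern l n (2 ^ k)|%:R * (2 ^ n)%:R)^-1
      * \sum_t \sum_alpha F k t alpha.
Proof.
pose G (k : 'I_l) (u : pattern l n (2 ^ k) * {ffun 'I_n -> bool}) :=
  (l%:R * #|pattern l n (2 ^ k)|%:R * (2 ^ n)%:R)^-1 * F k u.1 u.2.
transitivity (\sum_(k < l) \sum_u G k u).
  by rewrite (sig_big_dep (fun=> true) (fun _ _ => true) G).
by apply: eq_bigr => k _; rewrite pair_big -mulr_sumr.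
Qed.

Lemma sum_instance_weight : (0 < l)%N -> (0 < n)%N ->
  \sum_(j : instance) instance_weight j = 1.
Proof.
move=> l0 n0; have := sum_instance (fun _ _ _ => 1).
under eq_bigr do rewrite mulr1.
move=> ->; transitivity (\sum_(k < l) (l%:R^-1 : R)); last first.
  by rewrite sumr_const card_ord -[_ *+ l]mulr_natl mulfV // pnatr_eq0 -lt0n.
apply: eq_bigr => k _.
have T0 : #|pattern l n (2 ^ k)|%:R != 0 :> R.
  by rewrite pnatr_eq0 -lt0n pattern_gt0 // expn_gt0.
have E0 : (2 ^ n)%:R != 0 :> R by rewrite pnatr_eq0 -lt0n expn_gt0.
have L0 : l%:R != 0 :> R by rewrite pnatr_eq0 -lt0n.
rewrite !sumr_const card_ffun card_bool card_ord.
rewrite -[(2 ^ n)%:R *+ _]mulr_natl; field.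
by rewrite T0 E0 L0.
Qed.

Lemma yes_instance_unate (j : instance) : unate (yes_instance j).
Proof. exact: unate_hard. Qed.

(** As [k < l], at most [2 ^ k <= 2 ^ l / 2] coordinates are hidden. *)
Lemma no_instance_far (j : instance) : far_from_unate (1 / 8) (no_instance j).
Proof.
apply: hardNo_far; apply: leq_trans (_ : 2 * 2 ^ tag j <= _)%N.
  by rewrite leq_mul2l card_hidden_le.
by rewrite -expnS leq_exp2l.
Qed.

(** The bound for one seed, [G] being its decision. At each scale the gap is at most the collision
    probability; the constant 12 is the 6 of [sum_min_geometric] times the 2 of
    [sum_capturing_le]. *)
Lemma accept_gap (Q : seq (cube (l + n))) (G : (cube (l + n) -> R) -> bool) :
  (0 < l)%N -> (2 ^ l <= n)%N ->
  (forall f g, same_order_on Q f g -> G f = G g) ->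
  \sum_(j : instance) instance_weight j * (G (yes_instance j))%:R
  <= \sum_(j : instance) instance_weight j * (G (no_instance j))%:R
     + ((size Q)%:R ^+ 2 * ((2 ^ l)%:R / n%:R) ^+ 3
        + 12 * (size Q)%:R / (l%:R * n%:R)).
Proof.
move=> l0 ln hG.
have n0 : (0 < n)%N by apply: leq_trans ln; rewrite expn_gt0.
have n0' : (0 : R) < n%:R by rewrite ltr0n.
have l0' : (0 : R) < l%:R by rewrite ltr0n.
pose Fy (k : 'I_l) (t : pattern l n (2 ^ k)) (alpha : {ffun 'I_n -> bool}) : R :=
  (G (fun x => (hardYes (assign t) alpha x)%:R))%:R.
pose Fn (k : 'I_l) (t : pattern l n (2 ^ k)) (alpha : {ffun 'I_n -> bool}) : R :=
  (G (fun x => (hardNo (assign t) alpha x)%:R))%:R.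
rewrite (sum_instance Fy) (sum_instance Fn) -lerBlDl -sumrB.
pose S k : R := \sum_a Num.min (2 ^ k)%:R
                  (2 * #|capturing Q a|%:R ^+ 2 / (2 ^ k)%:R).
pose e : R := (size Q)%:R ^+ 2 * ((2 ^ l)%:R / n%:R) ^+ 3.
have step (k : 'I_l) :
    (l%:R * #|pattern l n (2 ^ k)|%:R * (2 ^ n)%:R)^-1 * (\sum_t \sum_alpha Fy k t alpha)
    - (l%:R * #|pattern l n (2 ^ k)|%:R * (2 ^ n)%:R)^-1 * (\sum_t \sum_alpha Fn k t alpha)
    <= l%:R^-1 * (e + S k / n%:R).
  have T0 : (0 : R) < #|pattern l n (2 ^ k)|%:R.
    by rewrite ltr0n pattern_gt0 // expn_gt0.
  have E0 : (0 : R) < (2 ^ n)%:R by rewrite ltr0n expn_gt0.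
  have kn : (2 ^ k <= n)%N by apply: leq_trans ln; rewrite leq_exp2l // ltnW.
  (* A pattern without collision contributes 0 by [sum_accept_eq], any other at most the number
     [2 ^ n] of sign vectors. *)
  have P : \sum_t \sum_alpha Fy k t alpha - \sum_t \sum_alpha Fn k t alpha
      <= (2 ^ n)%:R * #|[set t : pattern l n (2 ^ k) | collides Q t]|%:R.
    rewrite -sumrB -sum1dep_card natr_sum mulr_sumr [leRHS]big_mkcond /=.
    apply: ler_sum => t _; case: ifP => [_|/negbT nc].
      rewrite mulr1 -sumrB.
      apply: (@le_trans _ _ (\sum_(alpha : {ffun 'I_n -> bool}) 1)).
        by apply: ler_sum => alpha _; rewrite /Fy /Fn; case: (G _); case: (G _) => /=; lra.
      by rewrite sumr_const card_ffun card_bool card_ord.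
    rewrite subr_le0 -!natr_sum (sum_accept_eq hG) // => i j ri rj eij.
    apply/eqP; apply: contraNT nc => nij; apply/existsP; exists i.
    by apply/existsP; exists j; rewrite nij ri rj eij eqxx.
  rewrite -mulrBr.
  apply: (@le_trans _ _ (l%:R^-1 * (#|[set t : pattern l n (2 ^ k) | collides Q t]|%:R
                                    / #|pattern l n (2 ^ k)|%:R))).
    apply: le_trans (ler_wpM2l _ P) _; first by rewrite invr_ge0 !mulr_ge0 // ltW.
    rewrite le_eqVlt; apply/orP; left; apply/eqP; field.
    by rewrite !gt_eqF.
  rewrite ler_pM2l ?invr_gt0 //.
  apply: le_trans (prob_collides_le R Q _ kn) _; first by rewrite expn_gt0.
  rewrite lerD2r /e ler_wpM2l ?exprn_ge0 ?ler0n //.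
  rewrite lerXn2r ?nnegrE ?divr_ge0 ?ler0n //.
  by rewrite ler_pM2r ?invr_gt0 // ler_nat leq_exp2l // ltnW.
apply: le_trans (ler_sum _ (fun k _ => step k)) _.
rewrite -mulr_sumr big_split /= sumr_const card_ord -mulr_suml.
rewrite mulrDr -[e *+ l]mulr_natl mulrA mulVf ?gt_eqF // mul1r lerD2l.
have -> : 12 * (size Q)%:R / (l%:R * n%:R) = l%:R^-1 * (12 * (size Q)%:R / n%:R) :> R.
  by field; rewrite !gt_eqF.
rewrite ler_pM2l ?invr_gt0 // ler_pM2r ?invr_gt0 //.
(* Summing over the scales first, for a fixed coordinate, leaves a bound free of [l]; the factor
   [1 / l] of the average thus survives and yields the logarithm. *)
rewrite exchange_big /=.
apply: (@le_trans _ _ (\sum_(a : 'I_n) 6 * #|capturing Q a|%:R)).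
  by apply: ler_sum => a _; apply: sum_min_geometric.
rewrite -mulr_sumr -natr_sum.
have : (\sum_a #|capturing Q a|)%:R <= (2 * size Q)%:R :> R.
  by rewrite ler_nat sum_capturing_le.
rewrite natrM; lra.
Qed.

End Mixture.

(** The seedwise inequality is integrated against [P]; the constant [e] is preserved because [P] has
    total mass 1. *)
Lemma mixture_probability_le (R : realType) (disp : measure_display)
    (Omega : measurableType disp) (P : probability Omega R) (J : finType)
    (p : J -> R) (A B : J -> set Omega) (e : R) :
  (forall j, 0 <= p j) -> 0 <= e ->
  (forall j, measurable (A j)) -> (forall j, measurable (B j)) ->
  (forall w, \sum_j p j * \1_(A j) w <= \sum_j p j * \1_(B j) w + e) ->
  (\sum_j (p j)%:E * P (A j) <= \sum_j (p j)%:E * P (B j) + e%:E)%E.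
Proof.
move=> p0 e0 mA mB h.
have mI (D : J -> set Omega) j : measurable (D j) ->
    measurable_fun setT (fun w => (p j * \1_(D j) w)%:E).
  move=> mD; apply/measurable_EFinP; exact: measurable_funM.
have intE (D : J -> set Omega) : (forall j, measurable (D j)) ->
    (\sum_j (p j)%:E * P (D j)
     = \int[P]_w (\sum_j p j * \1_(D j) w)%:E)%E.
  move=> mD; under [RHS]eq_integral do rewrite -sumEFin.
  rewrite ge0_integral_sum //; last 2 first.
  - by move=> j; apply: mI.
  - by move=> j w _; rewrite lee_fin mulr_ge0 // indicE ler0n.
  apply: eq_bigr => j _; under eq_integral do rewrite EFinM.
  rewrite ge0_integralZl_EFin //.
  - by rewrite integral_indic // setIT.
  - by apply/measurable_EFinP.
have mS (D : J -> set Omega) : (forall j, measurable (D j)) ->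
    measurable_fun setT (fun w => (\sum_j p j * \1_(D j) w)%:E).
  move=> mD; apply/measurable_EFinP; apply: measurable_sum => j.
  by apply/measurable_EFinP; apply: mI.
have S0 (D : J -> set Omega) w : 0 <= \sum_j p j * \1_(D j) w.
  by apply: sumr_ge0 => j _; rewrite mulr_ge0 // indicE ler0n.
rewrite !intE //.
have -> : e%:E = (\int[P]_w e%:E)%E.
  rewrite integral_cst //=; have -> := @probability_setT _ _ _ P.
  by rewrite mule1.
rewrite -ge0_integralD //; [|by move=> w _; rewrite lee_fin..|exact: mS].
apply: ge0_le_integral => //.
- by move=> w _; rewrite lee_fin.
- exact: mS.
- by apply: emeasurable_funD => //; exact: mS.
- by move=> w _; rewrite -EFinD lee_fin.
Qed.

(** The unate mixture is accepted with probability at least 2/3 and the far one with probability at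
    most 1/3, so the bound on the gap must reach 1/3. *)
Lemma tester_gap (R : realType) (l n q : nat) (disp : measure_display)
    (Omega : measurableType disp) (P : probability Omega R)
    (T : nonadaptive_algorithm R Omega (l + n)) :
  (0 < l)%N -> (2 ^ l <= n)%N ->
  comparison_based T -> unateness_tester P (1 / 8) T -> makes_at_most T q ->
  1 / 3 <= q%:R ^+ 2 * ((2 ^ l)%:R / n%:R) ^+ 3 + 12 * q%:R / (l%:R * n%:R) :> R.
Proof.
move=> l0 ln cT [Tyes Tno] mT.
have n0 : (0 < n)%N by apply: leq_trans ln; rewrite expn_gt0.
set e : R := _ + _.
have e0 : 0 <= e.
  by rewrite addr_ge0 ?mulr_ge0 ?invr_ge0 ?exprn_ge0 ?mulr_ge0 ?divr_ge0 ?ler0n.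
pose A (f : instance l n -> cube (l + n) -> R) j := [set w | accepts T (f j) w]%classic.
have mA f j : measurable (A f j) by apply: measurable_accept.
have iA f j w : \1_(A f j) w = (accepts T (f j) w)%:R :> R.
  rewrite indicE; congr (nat_of_bool _)%:R.
  by apply/idP/idP => [/set_mem|h]; last exact/mem_set.
have gap w : \sum_j instance_weight R j * \1_(A (@yes_instance R l n) j) w
    <= \sum_j instance_weight R j * \1_(A (@no_instance R l n) j) w + e.
  under eq_bigr do rewrite iA.
  under [in leRHS]eq_bigr do rewrite iA.
  apply: le_trans (accept_gap (Q := query T w)
    (G := fun f => accepts T f w) l0 ln _) _; first by move=> f g; apply: cT.
  have sq : (size (query T w))%:R <= q%:R :> R by rewrite ler_nat mT.
  rewrite lerD2l; apply: lerD.
    rewrite ler_wpM2r ?exprn_ge0 ?divr_ge0 ?ler0n //.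
    by rewrite lerXn2r ?nnegrE ?ler0n.
  by rewrite ler_wpM2r ?invr_ge0 ?mulr_ge0 ?ler0n // ler_wpM2l.
have := mixture_probability_le P (@instance_weight_ge0 R l n) e0
          (mA (@yes_instance R l n)) (mA (@no_instance R l n)) gap.
have W1 := sum_instance_weight R l0 n0.
have lo : ((2 / 3)%:E <= \sum_j (instance_weight R j)%:E
              * P (A (@yes_instance R l n) j))%E.
  have -> : (2 / 3)%:E
      = (\sum_(j : instance l n) (instance_weight R j * (2 / 3))%:E)%E :> \bar R.
    by rewrite sumEFin -mulr_suml W1 mul1r.
  apply: lee_sum => j _; rewrite EFinM lee_wpmul2l //.
    by rewrite lee_fin instance_weight_ge0.
  by apply: Tyes; apply: yes_instance_unate.
have hi : (\sum_j (instance_weight R j)%:E * P (A (@no_instance R l n) j)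
            <= (1 / 3)%:E)%E.
  have -> : (1 / 3)%:E
      = (\sum_(j : instance l n) (instance_weight R j * (1 / 3))%:E)%E :> \bar R.
    by rewrite sumEFin -mulr_suml W1 !mul1r.
  apply: lee_sum => j _; rewrite EFinM lee_wpmul2l //.
    by rewrite lee_fin instance_weight_ge0.
  have := Tno _ (@no_instance_far R l n j).
  have -> : [set w | ~~ accepts T (no_instance R j) w]%classic
            = (~` A (@no_instance R l n) j)%classic.
    by apply/seteqP; split => w /= /negP.
  rewrite probability_setC //.
  have : P (A (@no_instance R l n) j) \is a fin_num by apply: fin_num_measure.
  case: (P _) => // r _; rewrite -EFinB !lee_fin; lra.
move=> h; have := le_trans lo (le_trans h (leeD hi (lexx e%:E))).
rewrite -EFinD lee_fin; lra.
Qed.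

(** * Choice of the parameters *)

Lemma ln_le_exp2 (R : realType) (d m : nat) :
  (0 < d)%N -> (d <= 2 ^ m)%N -> ln (d%:R : R) <= m%:R.
Proof.
move=> d0 dm; rewrite -[leRHS]expRK ler_ln ?posrE ?ltr0n ?expR_gt0 //.
apply: (@le_trans _ _ ((2 ^ m)%:R)); first by rewrite ler_nat.
rewrite natrX -[m%:R]mulr1 expRM_natl.
rewrite lerXn2r ?nnegrE ?expR_ge0 //.
(* [2 = 1 + 1] is at most [expR 1]. *)
exact: expR_ge1Dx.
Qed.

Theorem theorem3p2 (R : realType) :
  exists2 c : R, 0 < c &
  exists d0 : nat, forall d : nat, (d0 <= d)%N ->
  forall (disp : measure_display) (Omega : measurableType disp)
    (P : probability Omega R) (T : nonadaptive_algorithm R Omega d) (q : nat),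
  comparison_based T ->
  unateness_tester P (1 / 8) T ->
  makes_at_most T q ->
  c * (d%:R * ln (d%:R : R)) <= q%:R.
Proof.
(* [1536 = 16 * 96]: 16 comes from [ln d <= 16 * K], and 96 makes the two error terms small enough
   at the end. *)
exists (1 / 1536); first by lra.
(* This threshold makes [K] positive. The number [K] of scales is about an eighth of the binary
   logarithm, so that [2 ^ K] is at most the eighth root of [d]. *)
exists (2 ^ 8)%N => d dd.
pose K := (trunc_log 2 d %/ 8)%N.
have d0 : (0 < d)%N by apply: leq_trans dd.
have L8 : (8 <= trunc_log 2 d)%N by rewrite trunc_log_max.
have K0 : (0 < K)%N by rewrite divn_gt0.
have zd : ((2 ^ K) ^ 8 <= d)%N.
  rewrite -expnM; apply: leq_trans (@trunc_logP 2 d isT d0).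
  by rewrite leq_exp2l // leq_trunc_div.
have d16 : (d <= 2 ^ (16 * K))%N.
  apply: leq_trans (ltnW (trunc_log_ltn d (ltnSn 1))) _.
  by rewrite leq_exp2l //; rewrite /K; lia.
have lnd := ln_le_exp2 R d0 d16.
have Kz : (K < 2 ^ K)%N by apply: ltn_expl.
(* The far-pair term [q ^ 2 * (2 ^ K / n) ^ 3] with [q] below [d * 2 ^ K] is of order
   [(2 ^ K) ^ 5 / d]. *)
have z5 : ((2 ^ K) ^ 5 <= d)%N.
  by apply: leq_trans zd; rewrite leq_exp2l // (leq_trans _ Kz).
have z2 : (2 * 2 ^ K <= d)%N.
  apply: leq_trans zd; rewrite -expnS -expnM leq_exp2l //; lia.
have Kd : (K <= d)%N by lia.
pose n := (d - K)%N.
have dE : (d = K + n)%N by rewrite subnKC.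
have zn : (2 ^ K <= n)%N by rewrite /n; lia.
have n2 : (d <= 2 * n)%N by rewrite /n; lia.
clearbody n K; move: d0 dd L8 zd d16 lnd z5 z2 Kd n2; rewrite dE.
move=> d0 _ _ _ _ lnd z5 _ _ n2 disp Omega P T q cT tT mT.
rewrite leNgt; apply/negP => qlt.
have := tester_gap K0 zn cT tT mT.
move: lnd z5 n2 qlt.
set D := (K + n)%N in d0 *; set Z := (2 ^ K)%N.
rewrite natrM => lnd z5 n2 qlt.
have D0 : (0 : R) < D%:R by rewrite ltr0n.
have N0 : (0 : R) < n%:R by rewrite ltr0n; lia.
have K0' : (0 : R) < K%:R by rewrite ltr0n.
have Z0 : (0 : R) < Z%:R by rewrite ltr0n expn_gt0.
have KZ : (K%:R : R) <= Z%:R by rewrite ler_nat ltnW.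
have Z5 : (Z%:R : R) ^+ 5 <= D%:R by rewrite -natrX ler_nat.
have N2 : (D%:R : R) <= 2 * n%:R by rewrite -natrM ler_nat.
have q0 : (0 : R) <= q%:R by rewrite ler0n.
have qb : 96 * (q%:R : R) < D%:R * K%:R.
  have : (D%:R : R) * ln D%:R <= D%:R * (16 * K%:R) by rewrite ler_wpM2l // ltW.
  lra.
move: D0 N0 K0' Z0 KZ Z5 N2 q0 qb; clear.
move: (D%:R : R) (n%:R : R) (K%:R : R) (Z%:R : R) (q%:R : R).
clear=> D N k z Q D0 N0 k0 z0 kz z5 N2 Q0 Qb.
(* The bounds [1 / 4] and [1 / 12] add up to exactly [1 / 3]; the strict inequality here gives the
   contradiction. *)
have b2 : 12 * Q / (k * N) < 1 / 4.
  rewrite ltr_pdivrMr ?mulr_gt0 //.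
  have : D * k <= 2 * N * k by rewrite ler_wpM2r // ltW.
  lra.
have b1 : Q ^+ 2 * (z / N) ^+ 3 <= 1 / 12.
  apply: (@le_trans _ _ ((D * z / 96) ^+ 2 * (z / (D / 2)) ^+ 3)).
    apply: ler_pM; rewrite ?exprn_ge0 ?divr_ge0 ?(ltW z0) ?(ltW N0) //.
      rewrite lerXn2r ?nnegrE ?divr_ge0 ?mulr_ge0 ?(ltW D0) ?(ltW z0) //.
      have : D * k <= D * z by rewrite ler_wpM2l // ltW.
      lra.
    rewrite lerXn2r ?nnegrE ?divr_ge0 ?(ltW D0) ?(ltW z0) ?(ltW N0) //.
    rewrite ler_wpM2l ?(ltW z0) // lef_pV2 ?posrE ?divr_gt0 //.
    lra.
  have -> : (D * z / 96) ^+ 2 * (z / (D / 2)) ^+ 3 = z ^+ 5 / D * (1 / 1152).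
    by field; rewrite gt_eqF.
  have : z ^+ 5 / D <= 1 by rewrite ler_pdivrMr // mul1r.
  lra.
lra.
Qed.
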